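(* A graph $G$ has $\sigma(G) = 3$ if and only if $3 \le \chi(G) \le 4$, and $\sigma(G) = 4$ if and only if $5 \le \chi(G) \le 12$.
   Context: $\chi(G)$ is the chromatic number of $G$. An orientation covering of $G$ is a set of orientations $\overrightarrow{G_1},\dots,\overrightarrow{G_k}$ of $G$ such that for every vertex $u$ and any two distinct neighbors $v,w$ of $u$, some $\overrightarrow{G_i}$ contains both arcs $\overrightarrow{uv}$ and $\overrightarrow{uw}$. $\sigma(G)$ is the minimum size of an orientation covering of $G$. *)

(* Defs.v *)
From mathcomp Require Import all_boot.
Set Implicit Arguments.
Unset Strict Implicit.
Unset Printing Implicit Defensive.

Record sgraph := SGraph {
  vertex :> finType;
  edge : rel vertex;
  edge_sym : symmetric edge;
  edge_irrefl : irreflexive edge }.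

Section Defs.
Variable G : sgraph.

Definition proper_coloring (k : nat) (c : {ffun G -> 'I_k}) : bool :=
  [forall x : G, forall y : G, edge x y ==> (c x != c y)].

Definition colorable (k : nat) : bool :=
  [exists c : {ffun G -> 'I_k}, proper_coloring c].

(* [(x, y) \in D] means that [D] contains the arc from [x] to [y]; [(+)] is
   exclusive or. *)
Definition orientation (D : {set G * G}) : bool :=
  [forall x : G, forall y : G,
     (((x, y) \in D) ==> edge x y) &&
     (edge x y ==> ((x, y) \in D) (+) ((y, x) \in D))].

Definition orientation_covering (S : {set {set G * G}}) : bool :=
  [forall D in S, orientation D] &&
  [forall u : G, forall v : G, forall w : G,
     [&& edge u v, edge u w & v != w] ==>
     [exists D in S, ((u, v) \in D) && ((u, w) \in D)]].

Definition has_orientation_covering (k : nat) : bool :=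
  [exists S : {set {set G * G}}, orientation_covering S && (#|S| == k)].

Lemma ex_colorable : exists k, colorable k.
Proof.
exists #|G|; apply/existsP; exists [ffun x => enum_rank x].
apply/forallP=> x; apply/forallP=> y; apply/implyP=> exy; rewrite !ffunE.
apply/eqP=> /enum_rank_inj eq_xy.
by move: exy; rewrite eq_xy edge_irrefl.
Qed.

Lemma ex_orientation_covering : exists k, has_orientation_covering k.
Proof.
exists #|[set D : {set G * G} | orientation D]|.
apply/existsP; exists [set D | orientation D]; rewrite eqxx andbT.
apply/andP; split; first by apply/forall_inP=> D; rewrite inE.
apply/forallP=> u; apply/forallP=> v; apply/forallP=> w.
apply/implyP=> /and3P[euv euw _].
pose D := [set p : G * G | edge p.1 p.2 &&
  ((p.1 == u) || ((p.2 != u) && (enum_rank p.1 < enum_rank p.2)))].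
apply/existsP; exists D; rewrite !inE /= euv euw !eqxx !andbT.
apply/forallP=> x; apply/forallP=> y; rewrite !inE /=.
apply/andP; split; first by apply/implyP=> /andP[].
apply/implyP=> exy; rewrite (edge_sym y x) exy /=.
have nxy : x != y by apply: contraTneq exy => ->; rewrite edge_irrefl.
have [xu|nxu] /= := eqVneq x u.
  have [yu|nyu] //= := eqVneq y u; by move: nxy; rewrite xu yu eqxx.
have [//|nyu] /= := eqVneq y u.
case: ltngtP => // /val_inj/enum_rank_inj eq_xy.
by move: nxy; rewrite eq_xy eqxx.
Qed.

Definition chi : nat := ex_minn ex_colorable.
Definition sigma : nat := ex_minn ex_orientation_covering.

End Defs.

(* Main.v *)
(** For a fixed covering by [k] orientations, record for each arc [uv] the set
    of orientations that contain it. The sets of the arcs leaving [u] pairwise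
    intersect, and the set of [vu] is the complement of that of [uv]. So a
    maximal intersecting family of subsets of [[k]] that contains all the sets
    at [u] is a proper color for [u]. (Only a vertex with a single neighbor can
    have an empty set, and it is colored last.) Conversely, distinct maximal
    intersecting families are separated by a set and its complement, so a proper
    coloring by such families yields a covering. Hence [sigma G <= k] iff
    [chi G] is at most the number of maximal intersecting families on [k]
    points, and this number is 2, 4, 12 for [k] = 2, 3, 4. *)
Require Import Defs.
From mathcomp Require Import all_boot.
From mathcomp Require Import zify.
Set Implicit Arguments.
Unset Strict Implicit.
Unset Printing Implicit Defensive.

(** * Maximal intersecting families *)

(* A subset of a [k]-element set is its characteristic sequence of length [k]. *)
Definition compl (s : bitseq) : bitseq := map negb s.

Definition meets (s t : bitseq) : bool := has (fun p => p.1 && p.2) (zip s t).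

Fixpoint subsets (k : nat) : seq bitseq :=
  if k is k'.+1 then map (cons true) (subsets k') ++ map (cons false) (subsets k')
  else [:: [::]].

Fixpoint choices (l : seq bitseq) : seq (seq bitseq) :=
  if l is s :: l' then
    map (cons s) (choices l') ++ map (cons (compl s)) (choices l')
  else [:: [::]].

(* The subsets that contain the first point represent the pairs of
   complementary subsets; a maximal intersecting family picks one set from
   each pair. *)
Definition families (k : nat) : seq (seq bitseq) :=
  undup [seq M <- choices (map (cons true) (subsets k.-1)) | allrel meets M M].

Lemma complK : involutive compl.
Proof. by move=> s; rewrite /compl mapK //; exact: negbK. Qed.

Lemma size_compl s : size (compl s) = size s.
Proof. exact: size_map. Qed.

Lemma meetsC s t : meets s t = meets t s.
Proof. by elim: s t => [|a s IHs] [|b t] //=; rewrite /meets /= andbC -/(meets s t) IHs. Qed.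

Lemma meets_compl s : meets s (compl s) = false.
Proof. by elim: s => //= a s IHs; rewrite /meets /= andbN. Qed.

Lemma meets_self s : meets s s = has id s.
Proof. by elim: s => //= a s IHs; rewrite /meets /= andbb -/(meets s s) IHs. Qed.

Lemma meets_map (T : Type) (f g : pred T) (l : seq T) :
  meets (map f l) (map g l) = has (fun x => f x && g x) l.
Proof. by elim: l => //= x l IHl; rewrite /meets /= -/(meets _ _) IHl. Qed.

Lemma meetsP k s t : size s = k -> size t = k -> meets s t ->
  exists i : 'I_k, nth false s i && nth false t i.
Proof.
move=> sz_s sz_t /(has_nthP (false, false))[i].
rewrite size_zip sz_s sz_t minnn => lt_ik; rewrite nth_zip ?sz_s ?sz_t //= => st.
by exists (Ordinal lt_ik).
Qed.

Lemma mem_subsets k s : (s \in subsets k) = (size s == k).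
Proof.
elim: k s => [|k IHk] [|b s] //=; rewrite mem_cat.
  by apply/negbTE/norP; split; apply/mapP => -[].
have cons_mem c : (b :: s \in map (cons c) (subsets k)) = (b == c) && (size s == k).
  apply/mapP/andP => [[x]|[/eqP-> sz_s]]; last by exists s; rewrite ?IHk.
  by rewrite IHk => sz_x [-> ->].
by rewrite !cons_mem eqSS; case: (b) => /=; rewrite ?orbF.
Qed.

Lemma mem_choices_cons s l M : M \in choices (s :: l) ->
  exists2 N, N \in choices l & M = s :: N \/ M = compl s :: N.
Proof. by rewrite mem_cat => /orP[]/mapP[N inN ->]; exists N; auto. Qed.

Lemma choices_total l M s : M \in choices l -> s \in l ->
  (s \in M) || (compl s \in M).
Proof.
elim: l M => // t l IHl M /mem_choices_cons[N inN defM].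
rewrite inE => /predU1P[->|/(IHl _ inN)/orP sN].
  by case: defM => ->; rewrite !inE eqxx ?orbT.
by case: defM => ->; rewrite !inE; case: sN => ->; rewrite !orbT.
Qed.

Lemma size_mem_choices k l M s : all (fun t => size t == k) l ->
  M \in choices l -> s \in M -> size s = k.
Proof.
elim: l M => [|t l IHl] M /=; first by rewrite inE => _ /eqP->.
case/andP=> /eqP sz_t sz_l /mem_choices_cons[N inN [] ->];
by rewrite inE => /predU1P[->|/(IHl _ sz_l inN)] //; rewrite size_compl.
Qed.

(** Both lists run through the same pairs in the same order, so where they differ one holds a set
    and the other its complement. *)
Lemma choices_separated l M N : M \in choices l -> N \in choices l -> M != N ->
  has (fun s => compl s \in N) M.
Proof.
elim: l M N => [|t l IHl] M N; first by rewrite !inE => /eqP-> /eqP->.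
move=> /mem_choices_cons[M' inM' defM] /mem_choices_cons[N' inN' defN] neqMN.
have [eqMN|/(IHl _ _ inM' inN')/hasP[s sM' sN']] := eqVneq M' N'.
  case: defM defN neqMN => -> [] ->; rewrite eqMN ?eqxx //= => _;
  by rewrite inE ?complK eqxx.
apply/hasP; exists s; first by case: defM => ->; rewrite inE sM' orbT.
by case: defN => ->; rewrite inE sN' orbT.
Qed.

(* If [s] misses [a] and its complement misses [b] then [a] and [b] are
   disjoint. *)
Lemma meets_or_compl a b s : size a = size s -> size b = size s -> meets a b ->
  meets s a || meets (compl s) b.
Proof.
elim: s a b => [|c s IHs] [|x a] [|y b] //= [sz_a] [sz_b].
rewrite /meets /= -!/(meets _ _) => ab.
have := IHs a b sz_a sz_b.
by case: c x y ab => [] [] [] //= ab; rewrite ?orbT //; exact.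
Qed.

(** * Extending intersecting families *)

Lemma allrel_meets_cons s F : allrel meets (s :: F) (s :: F) =
  [&& has id s, all (meets s) F & allrel meets F F].
Proof.
rewrite allrel_cons2 meets_self; congr (_ && _).
have -> : all (meets^~ s) F = all (meets s) F by apply: eq_all => t; rewrite /= meetsC.
by rewrite andbA andbb.
Qed.

(** If some [a] in [F] misses [s], then every [b] in [F], since it meets [a], meets [compl s] by
    [meets_or_compl]. *)
Lemma intersecting_extend1 k s F : 0 < k -> size s = k ->
  all (fun t => size t == k) F -> allrel meets F F ->
  allrel meets (s :: F) (s :: F) || allrel meets (compl s :: F) (compl s :: F).
Proof.
move=> k_gt0 sz_s /allP sz_F FF; rewrite !allrel_meets_cons FF !andbT.
have sFE t : t \in F -> size t = size s by move/sz_F/eqP; rewrite sz_s.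
(* For empty [F] only nonemptiness is at stake, and [0 < k] makes [s] or its complement nonempty. *)
have self_or : has id s || has id (compl s).
  by case: s sz_s {sFE} => [|[] s] /= sz_s; rewrite ?orbT // -sz_s in k_gt0 *.
have Fself t : t \in F -> meets t t by move=> tF; exact: (allrelP FF).
have sub_self t x : meets t x -> has id t.
  by rewrite -meets_self; elim: t x => [|a t IHt] [|b x] //=;
    rewrite /meets /= -!/(meets _ _); case: a => //=; exact: IHt.
case: F sz_F FF sFE Fself => [|f F] sz_F FF sFE Fself; first by rewrite /= !andbT.
case: (boolP (all (meets s) _)) => [sall|/allPn[a aF nsa]].
  by rewrite (sub_self s f) //; apply: (allP sall); rewrite inE eqxx.
have csall : all (meets (compl s)) (f :: F).
  apply/allP => b bF; have := meets_or_compl (sFE a aF) (sFE b bF) (allrelP FF _ _ aF bF).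
  by rewrite (negPf nsa).
by rewrite csall (sub_self (compl s) f) ?orbT //; apply: (allP csall); rewrite inE eqxx.
Qed.

(** The pairs are settled one at a time; each chosen set joins [F] before the next choice, so later
    choices meet it too. *)
Lemma intersecting_choice k l F : 0 < k -> all (fun t => size t == k) l ->
  all (fun t => size t == k) F -> allrel meets F F ->
  exists2 M, M \in choices l & allrel meets (M ++ F) (M ++ F).
Proof.
move=> k_gt0; elim: l F => [|s l IHl] F /=; first by exists [::]; rewrite ?inE.
case/andP=> sz_s sz_l sz_F FF.
have ext t : size t == k -> allrel meets (t :: F) (t :: F) ->
    exists2 M, M \in choices l & allrel meets ((t :: M) ++ F) ((t :: M) ++ F).
  move=> sz_t /(IHl (t :: F) sz_l)[|M inM MF]; first by rewrite /= sz_t.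
  exists M => //; apply/allrelP => x y xM yM; apply: (allrelP MF).
    by move: xM; rewrite !(mem_cat, inE) orbCA orbA.
  by move: yM; rewrite !(mem_cat, inE) orbCA orbA.
have [sF|csF] := orP (intersecting_extend1 k_gt0 (eqP sz_s) sz_F FF).
  have [M inM MF] := ext s sz_s sF.
  by exists (s :: M); rewrite // mem_cat map_f.
have [|M inM MF] := ext (compl s) _ csF; first by rewrite size_compl.
by exists (compl s :: M); rewrite // mem_cat orbC map_f.
Qed.

Lemma size_half k : 0 < k ->
  all (fun t => size t == k) (map (cons true) (subsets k.-1)).
Proof.
case: k => // k _; apply/allP => _ /mapP[s + ->].
by rewrite mem_subsets eqSS.
Qed.

(** A choice that intersects with [F] must contain it: for [s] in [F] the set [compl s] is disjoint
    from [s], so its pair is settled in favor of [s]. *)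
Lemma families_extend k F : 0 < k -> all (fun t => size t == k) F ->
  allrel meets F F -> exists2 M, M \in families k & {subset F <= M}.
Proof.
move=> k_gt0 sz_F FF.
have [M inM MF] := intersecting_choice k_gt0 (size_half k_gt0) sz_F FF.
exists M.
  rewrite mem_undup mem_filter inM andbT; apply/allrelP => x y xM yM.
  by apply: (allrelP MF); rewrite mem_cat ?xM ?yM.
move=> s sF; have ncsM : compl s \notin M.
  apply/negP => csM; have := allrelP MF s (compl s).
  by rewrite meets_compl !mem_cat sF csM orbT => /(_ isT isT).
suff : (s \in M) || (compl s \in M) by rewrite (negPf ncsM) orbF.
(* The representatives contain the first point; a set that misses it is the complement of a
   representative. *)
case: k k_gt0 sz_F inM => // k _ /allP/(_ s sF) /= sz_s inM.
case: s sz_s {sF ncsM} => [|[] s] //; rewrite /= eqSS => sz_s.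
  by apply: (choices_total inM); rewrite map_f // mem_subsets.
rewrite orbC -[false :: s]complK; apply: (choices_total inM).
by rewrite map_f // mem_subsets size_compl.
Qed.

Lemma families_size k M s : 0 < k -> M \in families k -> s \in M -> size s = k.
Proof.
by move=> k_gt0; rewrite mem_undup mem_filter => /andP[_]; apply/size_mem_choices/size_half.
Qed.

Lemma families_meets k M s t : M \in families k -> s \in M -> t \in M -> meets s t.
Proof. by rewrite mem_undup mem_filter => /andP[/allrelP MM _]; exact: MM. Qed.

Lemma families_separated k M N : M \in families k -> N \in families k -> M != N ->
  has (fun s => compl s \in N) M.
Proof.
rewrite !mem_undup !mem_filter => /andP[_ inM] /andP[_ inN].
exact: choices_separated inN.
Qed.

(** Enumeration is cheap: even [k = 4] has only 8 complementary pairs, hence 256 choices to test. *)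
Lemma size_families2 : size (families 2) = 2. Proof. by vm_compute. Qed.
Lemma size_families3 : size (families 3) = 4. Proof. by vm_compute. Qed.
Lemma size_families4 : size (families 4) = 12. Proof. by vm_compute. Qed.

(** * Orientation coverings and colorings by families *)

Section Coverings.
Variable G : sgraph.

Lemma orientationP (D : {set G * G}) :
  reflect ((forall x y, (x, y) \in D -> edge x y) /\
           (forall x y, edge x y -> ((y, x) \in D) = ~~ ((x, y) \in D)))
          (orientation D).
Proof.
apply: (iffP forallP) => [oD|[Dedge Danti] x]; last first.
  apply/forallP => y; apply/andP; split; first by apply/implyP; exact: Dedge.
  by apply/implyP => /Danti->; case: (_ \in D).
split=> x y; have /forallP/(_ y)/andP[/implyP De /implyP Da] // := oD x.
by move/Da; case: (_ \in D); case: (_ \in D).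
Qed.

Lemma exists_orientation : exists D : {set G * G}, orientation D.
Proof.
exists [set p : G * G | edge p.1 p.2 && (enum_rank p.1 < enum_rank p.2)].
apply/orientationP; split=> x y; rewrite !inE /=; first by case/andP.
move=> exy; rewrite edge_sym exy /=; case: ltngtP => // /val_inj/enum_rank_inj eq_xy.
by move: exy; rewrite eq_xy edge_irrefl.
Qed.

Lemma orientation_coveringP (S : {set {set G * G}}) :
  reflect ((forall D, D \in S -> orientation D) /\
           (forall u v w, edge u v -> edge u w -> v != w ->
              exists2 D, D \in S & ((u, v) \in D) && ((u, w) \in D)))
          (orientation_covering S).
Proof.
apply: (iffP andP) => [[/forall_inP oS /forallP cS]|[oS cS]].
  split=> // u v w euv euw neq_vw.
  have /forallP/(_ v)/forallP/(_ w) := cS u.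
  by rewrite euv euw neq_vw => /exists_inP.
split; first by apply/forall_inP.
apply/forallP=> u; apply/forallP=> v; apply/forallP=> w.
by apply/implyP=> /and3P[euv euw neq_vw]; apply/exists_inP; exact: cS.
Qed.

(** * Minima as thresholds *)

Lemma sigma_leP k :
  reflect (exists2 S : {set {set G * G}}, orientation_covering S & #|S| <= k)
          (sigma G <= k).
Proof.
apply: (iffP idP); rewrite /sigma;
  case: ex_minnP => m /existsP[S /andP[covS /eqP cardS]] min_m.
  by exists S; rewrite ?cardS.
move=> [S' covS' le_S'k].
apply: leq_trans le_S'k; apply: min_m; apply/existsP.
by exists S'; rewrite covS' eqxx.
Qed.

Lemma chi_leP k :
  reflect (exists c : G -> 'I_k, forall x y, edge x y -> c x != c y) (chi G <= k).
Proof.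
apply: (iffP idP); rewrite /chi;
  case: ex_minnP => m /existsP[c /forallP cP] min_m.
  move=> le_mk; exists (fun x => widen_ord le_mk (c x)) => x y exy.
  by have /forallP/(_ y)/implyP/(_ exy) := cP x.
move=> [c' c'P]; apply: min_m; apply/existsP; exists (finfun c').
apply/forallP => x; apply/forallP => y; apply/implyP => exy.
by rewrite !ffunE c'P.
Qed.

(** Lets the families themselves serve as colors. *)
Lemma chi_le_size (T : eqType) (s : seq T) (c : G -> T) :
  (forall x, c x \in s) -> (forall x y, edge x y -> c x != c y) -> chi G <= size s.
Proof.
move=> cs cP; apply/chi_leP.
have ltc x : index (c x) s < size s by rewrite index_mem.
exists (fun x => Ordinal (ltc x)) => x y /cP; apply: contraNneq => -[eq_xy].
by rewrite -(nth_index (c x) (cs x)) eq_xy nth_index.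
Qed.

(** * From coverings to colorings *)

Lemma chi_le_families k : 1 < k -> 1 < size (families k) ->
  sigma G <= k -> chi G <= size (families k).
Proof.
move=> k_gt1 fam_gt1 /sigma_leP[S /orientation_coveringP[oS cS] le_Sk].
have [D0 oD0] := exists_orientation.
(* The covering may be smaller than [k]; copies of an arbitrary orientation bring the list to length
   exactly [k]. *)
pose Ds := enum S ++ nseq (k - #|S|) D0.
have sz_Ds : size Ds = k by rewrite size_cat size_nseq -cardE subnKC.
have oDs D : D \in Ds -> orientation D.
  by rewrite mem_cat mem_enum mem_nseq => /orP[/oS|/andP[_ /eqP->]].
pose out u v := [seq (u, v) \in D | D : {set G * G} <- Ds].
have sz_out u v : size (out u v) = k by rewrite size_map.
have outC u v : edge u v -> out v u = compl (out u v).
  move=> euv; rewrite /compl -map_comp; apply/eq_in_map => D /oDs/orientationP[_] /=.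
  exact.
have out_meets u v w : edge u v -> edge u w -> v != w -> meets (out u v) (out u w).
  move=> euv euw /(cS _ _ _ euv euw)[D DS Dvw]; rewrite meets_map.
  by apply/hasP; exists D => //; rewrite mem_cat mem_enum DS.
(* An intersecting family has no empty member, since each member must meet itself. *)
pose good u := [forall v, edge u v ==> has id (out u v)].
have good_fam u : exists M, (M \in families k) &&
    (good u ==> [forall v, edge u v ==> (out u v \in M)]).
  have [gu|_] := boolP (good u); last first.
    (* A placeholder: a vertex that is not good gets its final color in [col]. *)
    by exists (nth [::] (families k) 0); rewrite andbT mem_nth // ltnW.
  pose F := [seq out u v | v <- enum (edge u)].
  have [||M inM FM] := @families_extend k F (ltnW k_gt1).
  - by apply/allP => _ /mapP[v _ ->]; rewrite sz_out.
  - apply/allrelP => _ _ /mapP[v + ->] /mapP[w + ->]; rewrite !mem_enum => euv euw.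
    have [<-|] := eqVneq v w; last exact: out_meets.
    by rewrite meets_self; exact: (implyP (forallP gu v)).
  exists M; rewrite inM /=; apply/forallP => v; apply/implyP => euv.
  by apply: FM; rewrite map_f // mem_enum.
have [c0 c0P] := fin_all_exists good_fam.
have c0_out u v : good u -> edge u v -> out u v \in c0 u.
  by move=> gu euv; have /andP[_ /implyP/(_ gu)/forallP/(_ v)/implyP] := c0P u; exact.
(* A second neighbor would share with [v] an orientation containing both arcs, making [out u v]
   nonempty. *)
have bad_uniq u v : edge u v -> ~~ has id (out u v) -> forall w, edge u w -> w = v.
  move=> euv nuv w euw; apply/eqP/negPn; apply: contra nuv; rewrite eq_sym => neq_vw.
  have [D DS /andP[Dv _]] := cS u v w euv euw neq_vw.
  apply/hasP; exists true => //; apply/mapP; exists D => //.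
  by rewrite mem_cat mem_enum DS.
(* Were both ends bad, each would be the only neighbor of the other, and [out u v] and its
   complement would both be empty, against [k > 0]. *)
have bad_good u v : ~~ good u -> edge u v -> good v.
  case/forallPn=> v'; rewrite negb_imply => /andP[euv' nuv'] euv.
  have eq_v := bad_uniq _ _ euv' nuv' _ euv; rewrite -{v'}eq_v in euv' nuv'.
  apply/forallP=> w; apply/implyP=> evw; apply: contraNT nuv' => nvw.
  have evu : edge v u by rewrite edge_sym.
  move: (nvw); rewrite -(bad_uniq _ _ evw nvw _ evu) outC //; have := sz_out u v.
  by case: (out u v) => [|[] s] //=; move=> k0; rewrite -k0 in k_gt1.
have col u : exists M, (M \in families k) &&
    (if good u then M == c0 u else [forall v, edge u v ==> (M != c0 v)]).
  have [gu|/forallPn[v]] := boolP (good u).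
    by exists (c0 u); rewrite eqxx andbT; case/andP: (c0P u).
  rewrite negb_imply => /andP[euv nuv].
  (* Two families exist, so one remains for [u] besides that of its sole neighbor [v]. *)
  have [M MF neqM] : exists2 M, M \in families k & M != c0 v.
    have [eq0|neq0] := eqVneq (nth [::] (families k) 0) (c0 v); last first.
      by exists (nth [::] (families k) 0); rewrite // mem_nth // ltnW.
    exists (nth [::] (families k) 1); first exact: mem_nth.
    by rewrite -eq0 nth_uniq ?undup_uniq // ltnW.
  exists M; rewrite MF; apply/forallP => w; apply/implyP.
  by move/(bad_uniq _ _ euv nuv) ->.
have [c cP] := fin_all_exists col.
apply: (@chi_le_size _ _ c) => [x|x y exy]; first by case/andP: (cP x).
have [_ cx] := andP (cP x); have [_ cy] := andP (cP y).
have eyx : edge y x by rewrite edge_sym.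
case: (boolP (good x)) cx => gx cx; last first.
  have gy := bad_good _ _ gx exy; rewrite gy in cy.
  by rewrite (eqP cy); exact: (implyP (forallP cx y)).
case: (boolP (good y)) cy => gy cy; last first.
  by rewrite eq_sym (eqP cx); exact: (implyP (forallP cy x)).
(* A common family would contain the disjoint sets [out x y] and [out y x]. *)
rewrite (eqP cx) (eqP cy); apply/eqP => eq_c.
have := c0_out _ _ gx exy; have := c0_out _ _ gy eyx; rewrite -eq_c outC //.
have [c0F _] := andP (c0P x).
by move=> /(families_meets c0F) outM /outM; rewrite meetsC meets_compl.
Qed.

(** * From colorings to coverings *)

Lemma sigma_le_families k : 0 < k -> chi G <= size (families k) -> sigma G <= k.
Proof.
move=> k_gt0 /chi_leP[c cP].
pose fam (x : G) := nth [::] (families k) (c x).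
have famP x : fam x \in families k by rewrite mem_nth.
have fam_neq x y : edge x y -> fam x != fam y.
  by move/cP; rewrite nth_uniq ?undup_uniq.
(* The default is never taken along an edge: there the families differ, so the filtered list is
   nonempty. *)
pose sep x y := head [::] [seq s <- fam x | compl s \in fam y].
have sepP x y : edge x y -> (sep x y \in fam x) && (compl (sep x y) \in fam y).
  move/fam_neq/(families_separated (famP x) (famP y)); rewrite has_filter /sep.
  case def_l: [seq _ <- _ | _] => [|s l] // _.
  by have := mem_head s l; rewrite -{1}def_l mem_filter andbC.
(* [sep x y] and [sep y x] need not be complementary, so both arcs use the one that starts at the
   smaller color. *)
pose out x y := if c x < c y then sep x y else compl (sep y x).
have outP x y : edge x y -> out x y \in fam x.
  rewrite /out; case: ifP => _ exy; first by case/andP: (sepP x y exy).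
  by rewrite edge_sym in exy; case/andP: (sepP y x exy).
have outC x y : edge x y -> out y x = compl (out x y).
  by move/cP; rewrite /out -val_eqE /=; case: ltngtP; rewrite ?complK.
have sz_out x y : edge x y -> size (out x y) = k.
  by move/outP; apply: families_size.
pose D (i : 'I_k) := [set p : G * G | edge p.1 p.2 && nth false (out p.1 p.2) i].
(* Distinct [i] may give the same orientation, so only the bound [k] on the cardinal is available,
   and it suffices. *)
apply/sigma_leP; exists [set D i | i : 'I_k]; last first.
  by rewrite -[leqRHS]card_ord; exact: leq_imset_card.
apply/orientation_coveringP; split=> [_ /imsetP[i _ ->]|u v w euv euw _].
  apply/orientationP; split=> x y; rewrite !inE /=; first by case/andP.
  by move=> exy; rewrite (edge_sym y x) exy outC // (nth_map false) ?sz_out.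
have [i Di] := meetsP (sz_out _ _ euv) (sz_out _ _ euw)
                      (families_meets (famP u) (outP _ _ euv) (outP _ _ euw)).
by exists (D i); [exact: imset_f | rewrite !inE /= euv euw].
Qed.

Lemma sigma_leE k : 1 < k -> 1 < size (families k) ->
  (sigma G <= k) = (chi G <= size (families k)).
Proof.
move=> k_gt1 fam_gt1; apply/idP/idP; first exact: chi_le_families.
exact: sigma_le_families (ltnW k_gt1).
Qed.

End Coverings.

Theorem theorem16 (G : sgraph) :
  (sigma G = 3 <-> 3 <= chi G <= 4) /\ (sigma G = 4 <-> 5 <= chi G <= 12).
Proof.
(* Each value of [sigma G] is pinned between two consecutive thresholds, which become 2, 4 and 12
   for [chi G]. *)
have le2 := @sigma_leE G 2 isT; rewrite size_families2 in le2.
have le3 := @sigma_leE G 3 isT; rewrite size_families3 in le3.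
have le4 := @sigma_leE G 4 isT; rewrite size_families4 in le4.
move: (le2 isT) (le3 isT) (le4 isT); lia.
Qed.
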